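(* Let $T_1,\dots,T_{n_t}$ be target points on the $x$-axis with $x(T_1)\le\cdots\le x(T_{n_t})$, let $S$ be a finite set of sensors with coverage intervals $[u_s,v_s]$ (sensor $s$ covers $T_j$ iff $u_s\le x(T_j)\le v_s$), and let $K\ge 1$ be an integer. Assume some subset of $S$ $K$-covers all targets (every target is covered by at least $K$ sensors of the subset). Then the set of sensors output by the algorithm $K$-OGA (defined in the context) $K$-covers all targets and has the minimum cardinality among all subsets of $S$ that $K$-cover all targets.
   Context: OGA (order-based greedy algorithm), applied to a set of targets $NC$ with an available sensor set $RS$: repeatedly take the leftmost target of $NC$ not yet covered by the sensors selected in this run, and select from $RS$, among sensors covering it, one with the largest right endpoint (ties broken in favor of the sensor covering the most targets); stop when all targets of $NC$ are covered. $K$-OGA: set $s=1$, $RS_1=S$, $NC_1=$ all targets, and apply OGA to $NC_1$ using $RS_1$. Then, while some target is covered by fewer than $K$ selected sensors: increase $s$ by one, let $RS_s$ be the set of sensors of $S$ not selected so far and $NC_s$ the set of targets covered by fewer than $s$ selected sensors, and apply OGA to $NC_s$ using $RS_s$, adding the newly selected sensors to the selected set. The output is the set of all selected sensors. (Weak $K$-barrier coverage of a belt region is modeled this way: sensor coverage areas are projected orthogonally onto the boundary line, and the continuous interval to be $K$-covered is converted to discrete targets, one at the midpoint of each elementary interval determined by the interval endpoints.) *)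

(* Defs.v *)
From Stdlib Require Export Relation_Operators.
From mathcomp Require Export all_boot all_order all_algebra.

Set Implicit Arguments.
Unset Strict Implicit.
Unset Printing Implicit Defensive.

Import Order.TTheory GRing.Theory Num.Theory.
Local Open Scope ring_scope.

Section BarrierCoverage.

Context {R : realFieldType} {n : nat} {sensor : finType}.
Variables (x : 'I_n -> R) (u v : sensor -> R).

Definition covers (s : sensor) (j : 'I_n) : bool := u s <= x j <= v s.

Definition ncover (A : {set sensor}) (j : 'I_n) : nat :=
  #|[set s in A | covers s j]|.

Definition Kcovers (K : nat) (A : {set sensor}) : Prop :=
  forall j, (K <= ncover A j)%N.

Definition ntargets (s : sensor) : nat := #|[set j | covers s j]|.

Definition uncovered (NC : {set 'I_n}) (A : {set sensor}) : {set 'I_n} :=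
  [set j in NC | [forall s in A, ~~ covers s j]].

Definition leftmost (U : {set 'I_n}) (j : 'I_n) : Prop :=
  j \in U /\ forall i, i \in U -> x j <= x i.

(* Ties remaining after both criteria are left open: any best sensor may be
   chosen. *)
Definition best_sensor (RS : {set sensor}) (j : 'I_n) (s : sensor) : Prop :=
  [/\ s \in RS, covers s j &
      forall s', s' \in RS -> covers s' j ->
        v s' < v s \/ (v s' = v s /\ (ntargets s' <= ntargets s)%N)].

(* State of K-OGA inside its [level]-th run of OGA: [avail] and [todo] are the
   arguments RS_level and NC_level of that run, fixed when it starts; [cur]
   holds the sensors selected in that run, [sel] those selected in all runs so
   far, including [cur]. *)
Record state := State {
  level : nat;
  avail : {set sensor};
  todo : {set 'I_n};
  cur : {set sensor};
  sel : {set sensor}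
}.

Definition run_over (c : state) : Prop := uncovered (todo c) (cur c) = set0.

Definition kOGA_init (S : {set sensor}) : state := State 1 S setT set0 set0.

Inductive kOGA_step (S : {set sensor}) (K : nat) : state -> state -> Prop :=
| kOGA_select (c : state) (j : 'I_n) (s : sensor) :
    leftmost (uncovered (todo c) (cur c)) j ->
    best_sensor (avail c) j s ->
    kOGA_step S K c
      (State (level c) (avail c) (todo c) (s |: cur c) (s |: sel c))
| kOGA_next_run (c : state) :
    run_over c ->
    (exists j, (ncover (sel c) j < K)%N) ->
    kOGA_step S K c
      (State (level c).+1 (S :\: sel c)
         [set j | (ncover (sel c) j < (level c).+1)%N] set0 (sel c)).

Definition kOGA_reachable (S : {set sensor}) (K : nat) (c : state) : Prop :=
  clos_refl_trans state (kOGA_step S K) (kOGA_init S) c.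

(* The algorithm stops: its current run is over and the guard of its outer
   loop is false. *)
Definition kOGA_final (K : nat) (c : state) : Prop :=
  run_over c /\ ~ (exists j, (ncover (sel c) j < K)%N).

(* Since the algorithm makes arbitrary choices, "it produces an output" means
   that no execution is infinite and none gets stuck, as would happen if no
   available sensor covered the leftmost uncovered target. *)
Definition kOGA_terminates (S : {set sensor}) (K : nat) : Prop :=
  Acc (fun c' c => kOGA_step S K c c') (kOGA_init S) /\
  forall c, kOGA_reachable S K c ->
    kOGA_final K c \/ exists c', kOGA_step S K c c'.

Definition kOGA_output (S : {set sensor}) (K : nat) (A : {set sensor}) : Prop :=
  exists c, [/\ kOGA_reachable S K c, kOGA_final K c & sel c = A].

End BarrierCoverage.

(* Main.v *)
(** The partial selection always extends to a minimum K-cover [B]. Suppose run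
    [l] selects [s] for the leftmost target [j] that it has not yet covered,
    and [s] is not in [B]. The selected sensors cover [j] exactly [l - 1]
    times, so [B] contains at least [K - l + 1] unselected sensors covering
    [j]. Let [b] be the one of these with the largest left endpoint; then
    [B - b + s] is still a K-cover. At or to the right of [x j], [s] covers
    every target that [b] does, since it reaches furthest. A target to the left
    of [x j] covered by [b] is covered by all those [K - l + 1] sensors, and at
    least [l] times by selected ones because [j] is leftmost, so it can spare
    [b]. *)
Require Import Defs.
Import Order.TTheory GRing.Theory Num.Theory.
Local Open Scope ring_scope.

Section Coverage.

Set Implicit Arguments.
Unset Strict Implicit.

Context {R : realFieldType} {n : nat} {sensor : finType}.
Context (x : 'I_n -> R) (u v : sensor -> R).
Implicit Types (A B D S : {set sensor}) (s b : sensor) (i j : 'I_n).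

Local Notation covers := (covers x u v).
Local Notation ncover := (ncover x u v).
Local Notation Kcovers := (Kcovers x u v).

(** * Counting the sensors that cover a target *)

Lemma ncoverS A B j : A \subset B -> (ncover A j <= ncover B j)%N.
Proof.
move=> sAB; apply: subset_leq_card; apply/subsetP=> s; rewrite !inE.
by case/andP=> /(subsetP sAB)-> ->.
Qed.

Lemma ncoverD A D j :
  D \subset A -> ncover A j = (ncover D j + ncover (A :\: D) j)%N.
Proof.
move=> sDA; rewrite /Defs.ncover -(cardsID D [set s in A | covers s j]).
congr (_ + _)%N; apply: eq_card => s; rewrite !inE.
  by case: (boolP (s \in D)) => [/(subsetP sDA)-> | _]; rewrite ?andbT ?andbF.
by rewrite andbA.
Qed.

Lemma ncoverU1 s A j :
  s \notin A -> ncover (s |: A) j = (covers s j + ncover A j)%N.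
Proof.
move=> sA; have -> : ncover (s |: A) j = (ncover [set s] j + ncover A j)%N.
  by rewrite (@ncoverD (s |: A) [set s]) ?subsetUl // setU1K.
congr (_ + _)%N; rewrite /Defs.ncover; case: (boolP (covers s j)) => c_sj.
  rewrite -[RHS](cards1 s); apply: eq_card => t; rewrite !inE.
  by case: eqP => // ->.
apply: eq_card0 => t; rewrite !inE.
by case: eqP => // ->; rewrite (negbTE c_sj).
Qed.

Lemma ncover_gt0 A j :
  reflect (exists2 s, s \in A & covers s j) (0 < ncover A j)%N.
Proof.
apply: (iffP card_gt0P) => [[s] | [s sA c_sj]].
  by rewrite inE => /andP[sA c_sj]; exists s.
by exists s; rewrite inE sA.
Qed.

Lemma uncoveredE (T : {set 'I_n}) A j :
  (j \in uncovered x u v T A) = (j \in T) && (ncover A j == 0)%N.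
Proof.
rewrite inE; congr (_ && _); rewrite -leqn0 leqNgt.
apply/forall_inP/negP => [nc /ncover_gt0[s /nc/negP] // | nc s sA].
by apply/negP => c_sj; apply/nc/ncover_gt0; exists s.
Qed.

(** * Existence of the greedy choices *)

Lemma leftmost_exists (U : {set 'I_n}) : U != set0 -> exists j, leftmost x U j.
Proof.
case/set0Pn=> j0 Uj0.
by exists [arg min_(j < j0 in U) x j]%O; case: arg_minP => // j Uj minj; split.
Qed.

Lemma best_sensor_exists S j :
  (0 < ncover S j)%N -> exists s, best_sensor x u v S j s.
Proof.
case/ncover_gt0 => s0 s0S c0.
pose P := [pred s | (s \in S) && covers s j].
have [s1 /andP[s1S c1] max1] :=
  @arg_maxP _ _ _ s0 P v (introT andP (conj s0S c0)).
(* The tie-break is a second maximisation, among the sensors sharing the largest right endpoint. *)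
pose Q := [pred s | P s && (v s == v s1)].
have Qs1 : Q s1 by rewrite /= s1S c1 eqxx.
case: (@arg_maxnP _ s1 Q (ntargets x u v) Qs1) => s.
case/andP=> /andP[sS cs] /eqP vs max2.
exists s; split=> // t tS ct.
have := max1 t; rewrite /= tS ct => /(_ isT); rewrite le_eqVlt vs.
case/orP=> [/eqP vt | ]; last by left.
by right; split=> //; apply: max2; rewrite /= tS ct vt eqxx.
Qed.

(** * Minimum covers and the exchange argument *)

Definition min_Kcover S (K : nat) B : Prop :=
  [/\ B \subset S, Kcovers K B &
      forall B', B' \subset S -> Kcovers K B' -> (#|B| <= #|B'|)%N].

Lemma min_Kcover_exists S (K : nat) B0 :
  B0 \subset S -> Kcovers K B0 -> exists B, min_Kcover S K B.
Proof.
move=> sB0 cB0.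
pose P := [pred B : {set sensor} |
  (B \subset S) && [forall j, (K <= ncover B j)%N]].
have PB0 : P B0 by rewrite /= sB0; apply/forallP.
case: (@arg_minnP _ B0 P (fun B => #|B|) PB0) => B /andP[sB /forallP cB] minB.
exists B; split=> // B' sB' cB'; apply: minB.
by rewrite /= sB'; apply/forallP.
Qed.

(** Applied with [A] the current selection and [l] one less than the number of the run, so that [j]
    still lacks its cover number [l.+1] and every target to its left has it. *)
Lemma exchange S (K l : nat) A B j s :
    (l < K)%N -> min_Kcover S K B -> A \subset B ->
    (ncover A j <= l)%N ->
    (forall i, x i < x j -> (l < ncover A i)%N) ->
    s \notin A -> best_sensor x u v (S :\: A) j s ->
  exists2 B', min_Kcover S K B' & s |: A \subset B'.
Proof.
move=> ltlK [sBS cB minB] sAB cAj left_covered sA [sSA c_sj best_s].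
case: (boolP (s \in B)) => sB.
  by exists B; rewrite // subUset sub1set sB.
have ncBA i := ncoverD i sAB.
have nBAj : (K - l <= ncover (B :\: A) j)%N.
  by rewrite leq_subLR (leq_trans (cB j)) // ncBA leq_add2r.
have /ncover_gt0[b0 b0BA c_b0j] : (0 < ncover (B :\: A) j)%N.
  by apply: leq_trans nBAj; rewrite subn_gt0.
pose P := [pred t | (t \in B :\: A) && covers t j].
have [b /andP[bBA c_bj] max_b] :=
  @arg_maxP _ _ _ b0 P u (introT andP (conj b0BA c_b0j)).
have /setDP[bB bA] := bBA.
have sBb : s \notin B :\ b by rewrite !inE (negbTE sB) andbF.
have vbs : v b <= v s.
  have bSA : b \in S :\: A by rewrite inE bA (subsetP sBS).
  by case: (best_s b bSA c_bj) => [/ltW | [-> _]].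
have cardB' : #|s |: B :\ b| = #|B| by rewrite cardsU1 sBb (cardsD1 b B) bB.
exists (s |: B :\ b); last first.
  rewrite setUS //; apply/subsetP=> t tA; rewrite !inE (subsetP sAB) // andbT.
  by apply: contraNneq bA => <-.
split=> [|i|B' sB' cB']; last by rewrite cardB'; apply: minB.
  rewrite subUset sub1set (subset_trans (subsetDl _ _)) // andbT.
  by case/setDP: sSA.
have ncBb : ncover B i = (covers b i + ncover (B :\ b) i)%N.
  by rewrite -[in LHS](setD1K bB) ncoverU1 // !inE eqxx.
rewrite ncoverU1 //; case: (boolP (covers b i)) ncBb => c_bi /= ncBb; last first.
  by rewrite (leq_trans (cB i)) // ncBb leq_addl.
have [/andP[ubi vbi] /andP[usj _]] := (c_bi, c_sj).
case: (leP (x j) (x i)) => [lexji | ltxij].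
  suff -> : covers s i by rewrite -ncBb.
  by rewrite /Defs.covers (le_trans usj) // (le_trans vbi).
(* One cover more than needed at [i] makes up for the loss of [b]. *)
suff ltKB : (K < ncover B i)%N.
  by rewrite ncBb ltnS in ltKB; rewrite (leq_trans ltKB) // leq_addl.
have nBAi : (ncover (B :\: A) j <= ncover (B :\: A) i)%N.
  apply: subset_leq_card; apply/subsetP=> t /setIdP[tBA c_tj].
  apply/setIdP; split=> //; have := max_b t; rewrite /= tBA c_tj => /(_ isT) leub.
  have /andP[_ vtj] := c_tj.
  by rewrite /Defs.covers (le_trans leub) //= (le_trans (ltW ltxij)).
(* [A] contributes [l.+1] covers of [i], and [B :\: A] contributes [K - l]. *)
have -> : K.+1 = (l.+1 + (K - l))%N by rewrite addSn subnKC // ltnW.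
by rewrite ncBA leq_add ?left_covered // (leq_trans nBAj).
Qed.

End Coverage.

(** * The invariant of K-OGA *)

Section KOGA.

Set Implicit Arguments.
Unset Strict Implicit.

Context {R : realFieldType} {n : nat} {sensor : finType}.
Context (x : 'I_n -> R) (u v : sensor -> R) (S : {set sensor}) (K : nat).

Local Notation state := (@state n sensor).
Local Notation ncover := (ncover x u v).
Local Notation kOGA_step := (kOGA_step x u v S K).
Local Notation old c := (sel c :\: cur c).

Record kOGA_inv (c : state) : Prop := KOGAInv {
  inv_level_gt0 : (0 < level c)%N;
  inv_level_le : (level c <= K)%N;
  inv_cur : cur c \subset sel c;
  inv_avail : avail c = S :\: old c;
  inv_todo : todo c = [set j | (ncover (old c) j < level c)%N];
  inv_old : forall j, (level c <= (ncover (old c) j).+1)%N;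
  inv_opt : exists2 B, min_Kcover x u v S K B & sel c \subset B
}.

Lemma kOGA_inv_init :
    (0 < K)%N -> (exists2 B : {set sensor}, B \subset S & Kcovers x u v K B) ->
  kOGA_inv (kOGA_init S).
Proof.
move=> K_gt0 [B0 sB0 cB0]; split; rewrite //= ?setD0 //.
  apply/setP=> j; rewrite !inE ltnS leqn0; apply/esym/eqP.
  by apply: eq_card0 => s; rewrite !inE.
by have [B optB] := min_Kcover_exists sB0 cB0; exists B; rewrite ?sub0set.
Qed.

(** Either [j] was not to be treated in this run, and [old c] suffices, or [cur c] adds a cover to
    the [level c - 1] older ones. *)
Lemma ncover_sel (c : state) j :
    kOGA_inv c -> j \notin uncovered x u v (todo c) (cur c) ->
  (level c <= ncover (sel c) j)%N.
Proof.
move=> I; rewrite (ncoverD x u v j (inv_cur I)) uncoveredE (inv_todo I) inE.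
rewrite negb_and -leqNgt -lt0n => /orP[leol | cur_gt0].
  by rewrite (leq_trans leol) // leq_addl.
by rewrite (leq_trans (inv_old I j)) // -add1n leq_add2r.
Qed.

Lemma uncovered_sel (c : state) j :
    kOGA_inv c -> j \in uncovered x u v (todo c) (cur c) ->
  (ncover (sel c) j < level c)%N.
Proof.
move=> I; rewrite (ncoverD x u v j (inv_cur I)) uncoveredE (inv_todo I) inE.
by case/andP=> lt_ol /eqP->.
Qed.

(** [avail c] still contains the sensors picked in this run, but none of them covers an uncovered
    target. Hence [s] is new, and best among all unselected sensors, as [exchange] requires. *)
Lemma best_notin_sel (c : state) j s :
    kOGA_inv c -> j \in uncovered x u v (todo c) (cur c) ->
    best_sensor x u v (avail c) j s ->
  s \notin sel c /\ best_sensor x u v (S :\: sel c) j s.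
Proof.
move=> I Uj [sS c_sj best_s].
have s_cur : s \notin cur c.
  move: Uj; rewrite uncoveredE => /andP[_]; apply: contraTN => s_cur.
  by rewrite -lt0n; apply/ncover_gt0; exists s.
move: sS; rewrite (inv_avail I) !inE s_cur /= => /andP[s_sel sS].
split=> //; split=> //; first by rewrite inE s_sel.
move=> t /setDP[tS t_sel]; apply: best_s.
by rewrite (inv_avail I) !inE (negbTE t_sel) andbF.
Qed.

Lemma kOGA_inv_step (c c' : state) : kOGA_inv c -> kOGA_step c c' -> kOGA_inv c'.
Proof.
move=> I st; case: c c' / st I.
  move=> c j s [Uj leftj] best_s I.
  have [s_sel best_s'] := best_notin_sel I Uj best_s.
  have old' : (s |: sel c) :\: (s |: cur c) = old c.
    apply/setP=> t; rewrite !inE.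
    by case: eqP => // -> /=; rewrite (negbTE s_sel) andbF.
  have [B optB sB] := inv_opt I.
  split; rewrite /= ?old' ?setUS ?(inv_level_gt0 I) ?(inv_level_le I) //.
  - exact: inv_cur.
  - exact: inv_avail.
  - exact: inv_todo.
  - exact: inv_old.
  (* The positive level is rewritten as [l.+1] to fit [exchange]. *)
  have predK l : (level c = l.+1)%N -> (l < K)%N by move=> <-; exact: inv_level_le.
  case: (level c) (inv_level_gt0 I) predK (@uncovered_sel c j I Uj)
    (@ncover_sel c ^~ I) => // l _ /(_ l erefl) ltlK ncj nci.
  apply: (exchange ltlK optB sB ncj) => // i ltxij; apply: nci.
  by apply/negP=> /leftj; rewrite leNgt ltxij.
move=> c over [j ltjK] I.
(* This is [inv_old] for the next run, whose [old] part is all of [sel c]; with the target [j] from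
   the loop guard it also gives [level c < K]. *)
have cov i : (level c <= ncover (sel c) i)%N.
  by apply: ncover_sel => //; rewrite over inE.
split; rewrite /= ?sub0set ?setD0 //.
- exact: leq_ltn_trans (cov j) ltjK.
- exact: inv_opt.
Qed.

(** * Termination and progress *)

Definition kOGA_measure (c : state) : nat := ((K - level c) + (#|S| - #|sel c|))%N.

(** A selection lowers the second summand, a new run the first. The invariant of the successor state
    keeps the truncated subtractions strict: its selection lies in [S] and its level is at most
    [K]. *)
Lemma kOGA_measure_step (c c' : state) :
  kOGA_inv c -> kOGA_step c c' -> (kOGA_measure c' < kOGA_measure c)%N.
Proof.
move=> I st; have I' := kOGA_inv_step I st; case: c c' / st I I'.
  move=> c j s [Uj _] /= best_s I I'.
  have [s_sel _] := best_notin_sel I Uj best_s.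
  rewrite /kOGA_measure /= ltn_add2l ltn_sub2l //; last by rewrite cardsU1 s_sel.
  have [B [sBS _ _] sB] := inv_opt I'.
  have := subset_leq_card (subset_trans sB sBS).
  by rewrite /= cardsU1 s_sel.
move=> c _ _ _ /inv_level_le ltcK.
by rewrite /kOGA_measure /= ltn_add2r ltn_sub2l.
Qed.

Lemma kOGA_inv_reachable (c : state) :
  kOGA_inv (kOGA_init S) -> kOGA_reachable x u v S K c -> kOGA_inv c.
Proof.
rewrite /kOGA_reachable => I0 r; elim: r I0 => //.
  by move=> c1 c2 st I1; exact: kOGA_inv_step st.
by move=> c1 c2 c3 _ IH1 _ IH2 /IH1.
Qed.

Lemma kOGA_inv_Acc (c : state) : kOGA_inv c -> Acc (fun c' c => kOGA_step c c') c.
Proof.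
have [m] := ubnP (kOGA_measure c); elim: m c => [|m IHm] c; first by rewrite ltn0.
rewrite ltnS => lecm I; constructor=> c' st; apply: IHm (kOGA_inv_step I st).
exact: leq_trans (kOGA_measure_step I st) lecm.
Qed.

Lemma kOGA_progress (c : state) :
  kOGA_inv c -> kOGA_final x u v K c \/ exists c', kOGA_step c c'.
Proof.
move=> I; case: (eqVneq (uncovered x u v (todo c) (cur c)) set0) => [over | Un0].
  case: (boolP [exists j, (ncover (sel c) j < K)%N]) => [/existsP ex | /existsP nex].
    by right; eexists; apply: kOGA_next_run.
  by left.
right; have [j left_j] := leftmost_exists x Un0; have [Uj _] := left_j.
have [B [sBS cB _] sB] := inv_opt I.
(* The optimal [B] covers [j] more often than [sel c] does, so a sensor of [B :\: sel c] covers [j],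
   and it is available. *)
have ltsB : (ncover (sel c) j < ncover B j)%N.
  apply: leq_trans (uncovered_sel I Uj) _.
  exact: leq_trans (inv_level_le I) (cB j).
have [|s best_s] := @best_sensor_exists _ _ _ x u v (avail c) j.
  apply: (@leq_trans (ncover (B :\: sel c) j)).
    by move: ltsB; rewrite (ncoverD x u v j sB) -[X in (X < _)%N]addn0 ltn_add2l.
  by apply: ncoverS; rewrite (inv_avail I) setDSS // subsetDl.
by eexists; apply: kOGA_select left_j best_s.
Qed.

End KOGA.

Theorem theorem3 (R : realFieldType) (nt : nat) (x : 'I_nt -> R)
    (x_sorted : forall i j : 'I_nt, (i <= j)%N -> x i <= x j)
    (sensor : finType) (S : {set sensor}) (u v : sensor -> R)
    (K : nat) (K_ge1 : (1 <= K)%N)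
    (feasible : exists2 B : {set sensor}, B \subset S & Kcovers x u v K B) :
  kOGA_terminates x u v S K /\
  forall A : {set sensor}, kOGA_output x u v S K A ->
    [/\ A \subset S,
        Kcovers x u v K A &
        forall B : {set sensor}, B \subset S -> Kcovers x u v K B ->
          (#|A| <= #|B|)%N].
Proof.
have I0 := kOGA_inv_init K_ge1 feasible.
split.
  split=> [|c /(kOGA_inv_reachable I0)]; first exact: kOGA_inv_Acc.
  exact: kOGA_progress.
move=> A [c [/(kOGA_inv_reachable I0) I [_ done_c] <-]].
(* The output lies inside a minimum cover [B], which bounds its size; the false loop guard makes it
   a cover itself. *)
have [B [sBS cB minB] sB] := inv_opt I.
split=> [|j|B' sB' cB']; first exact: subset_trans sB sBS.
  by rewrite leqNgt; apply/negP=> ltjK; apply: done_c; exists j.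
exact: leq_trans (subset_leq_card sB) (minB B' sB' cB').
Qed.
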